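(* Let $n\ge2$ and let $\mathcal{Q}$ be a real symmetric $n\times n$ matrix that is positive semidefinite with $\ker(\mathcal{Q})=\operatorname{span}(\bm{1})$. Let $\lambda_1\ge\dots\ge\lambda_{n-1}>\lambda_n=0$ be its eigenvalues with orthonormal eigenvectors $\bm{v}_1,\dots,\bm{v}_{n-1},\bm{v}_n=\bm{1}/\sqrt n$. Let $B=[\bm{b}_1\cdots\bm{b}_n]\in\mathbb{R}^{(n-1)\times n}$ with $(\bm{b}_i)_k=\lambda_k^{-1/2}(\bm{v}_k)_i$ for $k=1,\dots,n-1$, define $\varphi:\mathbb{R}^n\to\mathbb{R}^{n-1}$ by $\varphi(\bm{f})=B\bm{f}$, and let $S:=\operatorname{conv}\{\varphi(\bm{1}_1),\dots,\varphi(\bm{1}_n)\}$ (a simplex). Let $\Omega$ be the matrix with entries $\Omega_{ab}=(\bm{1}_a-\bm{1}_b)^{\top}\mathcal{Q}^{\dagger}(\bm{1}_a-\bm{1}_b)$, and set $\bm{p}:=\Omega^{-1}\bm{1}/(\bm{1}^{\top}\Omega^{-1}\bm{1})$ and $\sigma^2:=\tfrac12(\bm{1}^{\top}\Omega^{-1}\bm{1})^{-1}$. Then the circumcenter of $S$ is $\varphi(\bm{p})$ and its circumradius equals $\sigma$ (i.e. $\|\varphi(\bm{p})-\varphi(\bm{1}_i)\|^2=\sigma^2$ for all $i\in[n]$).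
   Context: $\mathcal{Q}$ is the Laplacian of a possibly signed undirected graph ($\mathcal{Q}\bm{1}=\bm{0}$, off-diagonal entries of any sign); $\mathcal{Q}^{\dagger}$ is its Moore–Penrose pseudoinverse, $\Omega$ is invertible, and $\sigma^2>0$. $\bm{1}_i$ is the $i$-th standard basis vector and $\bm{1}$ the all-ones vector. The map $\varphi$ is the generalized resistive embedding: $\|\varphi(\bm{1}_i)-\varphi(\bm{1}_j)\|^2=\Omega_{ij}$. *)

(* Defs.v *)
From HB Require Import structures.
From mathcomp Require Import all_boot all_order all_algebra.
From mathcomp Require Import boolp classical_sets reals.

Set Implicit Arguments.
Unset Strict Implicit.
Unset Printing Implicit Defensive.

Import Order.TTheory GRing.Theory Num.Theory.

Local Open Scope classical_set_scope.
Local Open Scope ring_scope.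

Section MoorePenrose.
Variable R : realType.

Definition penrose (m n : nat) (A : 'M[R]_(m, n)) (X : 'M[R]_(n, m)) : Prop :=
  [/\ A *m X *m A = A, X *m A *m X = X,
      (A *m X)^T = A *m X & (X *m A)^T = X *m A].

(* The default value 0 is never used, see [mpinvP]. *)
Definition mpinv (m n : nat) (A : 'M[R]_(m, n)) : 'M[R]_(n, m) :=
  xget 0 [set X | penrose A X].

Lemma gram_unitmx (m n : nat) (A : 'M[R]_(m, n)) :
  row_free A -> A *m A^T \in unitmx.
Proof.
move=> fA; rewrite -row_free_unit -kermx_eq0; apply/eqP/row_matrixP => i.
rewrite row0; set u := row i _.
have uA0 : u *m (A *m A^T) = 0 by rewrite -row_mul mulmx_ker row0.
suff uA : u *m A = 0 by apply: (row_free_inj fA); rewrite uA mul0mx.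
have : (u *m A) *m (u *m A)^T = 0.
  by rewrite trmx_mul mulmxA -(mulmxA u) uA0 mul0mx.
move=> /matrixP /(_ 0 0); rewrite !mxE => /eqP.
rewrite psumr_eq0 => [/allP h|k _]; last by rewrite [_^T _ _]mxE -expr2 sqr_ge0.
apply/rowP => j; have := h j (mem_index_enum j).
by rewrite /= [_^T _ _]mxE -expr2 sqrf_eq0 [RHS]mxE => /eqP.
Qed.

Lemma mpinvP (m n : nat) (A : 'M[R]_(m, n)) : penrose A (mpinv A).
Proof.
suff [X PX] : exists X, penrose A X.
  exact: (@xgetI _ 0 [set X | penrose A X] X PX).
have [r [C [D [-> uC uD]]]] : exists (r : nat) (C : 'M[R]_(m, r))
    (D : 'M[R]_(r, n)),
    [/\ A = C *m D, C^T *m C \in unitmx & D *m D^T \in unitmx].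
  exists (\rank A), (col_base A), (row_base A); rewrite mulmx_base; split=> //.
    rewrite -{2}[col_base A]trmxK; apply: gram_unitmx.
    by rewrite /row_free mxrank_tr; exact: col_base_full.
  by apply: gram_unitmx; exact: row_base_free.
pose X := D^T *m invmx (D *m D^T) *m invmx (C^T *m C) *m C^T.
have AX : C *m D *m X = C *m invmx (C^T *m C) *m C^T.
  by rewrite /X !mulmxA -(mulmxA C D) mulmxK.
have XA : X *m (C *m D) = D^T *m invmx (D *m D^T) *m D.
  by rewrite /X !mulmxA -(mulmxA _ C^T C) mulmxKV.
exists X; split.
- by rewrite AX !mulmxA -(mulmxA _ C^T C) mulmxKV.
- by rewrite XA /X !mulmxA -(mulmxA _ D D^T) mulmxKV.
- by rewrite AX !trmx_mul trmx_inv trmx_mul !trmxK mulmxA.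
- by rewrite XA !trmx_mul trmx_inv trmx_mul !trmxK mulmxA.
Qed.

Lemma penrose_uniq (m n : nat) (A : 'M[R]_(m, n)) (X Y : 'M[R]_(n, m)) :
  penrose A X -> penrose A Y -> X = Y.
Proof.
move=> [AXA XAX AXt XAt] [AYA YAY AYt YAt].
have eA : A *m X = A *m Y.
  rewrite -{1}AYA -mulmxA -[A *m Y]trmxK -[A *m X]trmxK -trmx_mul AXt AYt.
  by rewrite mulmxA AXA.
have eB : X *m A = Y *m A.
  transitivity ((X *m A) *m (Y *m A)); first by rewrite -mulmxA [A *m _]mulmxA AYA.
  by rewrite -XAt -YAt -trmx_mul -mulmxA [A *m _]mulmxA AXA.
by rewrite -XAX eB -mulmxA eA mulmxA YAY.
Qed.

End MoorePenrose.

Section EuclideanGeometry.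
Variables (R : realType) (d : nat).
Implicit Types (S : set 'cV[R]_d) (c x : 'cV[R]_d).

(* The library norm on matrices is the max norm. *)
Definition enorm x : R := Num.sqrt (\sum_i x i 0 ^+ 2).

Definition conv_hull (k : nat) (w : 'I_k -> 'cV[R]_d) : set 'cV[R]_d :=
  [set x | exists a : 'I_k -> R,
    [/\ forall i, 0 <= a i, \sum_i a i = 1 & x = \sum_i a i *: w i]].

Definition affine_hull S : set 'cV[R]_d :=
  [set x | exists (k : nat) (w : 'I_k -> 'cV[R]_d) (a : 'I_k -> R),
    [/\ forall i, S (w i), \sum_i a i = 1 & x = \sum_i a i *: w i]].

Definition affinely_independent (k : nat) (w : 'I_k -> 'cV[R]_d) : Prop :=
  forall a : 'I_k -> R,
    \sum_i a i = 0 -> \sum_i a i *: w i = 0 -> forall i, a i = 0.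

(* The vertices of a polytope are its extreme points. *)
Definition vertices S : set 'cV[R]_d :=
  [set x | S x /\ forall (y z : 'cV[R]_d) (t : R), S y -> S z -> 0 < t < 1 ->
    x = t *: y + (1 - t) *: z -> y = x /\ z = x].

Definition circumscribed S c (r : R) : Prop :=
  [/\ affine_hull S c, 0 <= r & forall x, vertices S x -> enorm (c - x) = r].

Definition is_circumcenter S c : Prop :=
  unique (fun c' => exists r, circumscribed S c' r) c.

Definition is_circumradius S (r : R) : Prop :=
  exists2 c, is_circumcenter S c & circumscribed S c r.

End EuclideanGeometry.

Section Resistance.
Variables (R : realType) (n : nat).
Implicit Types (Q Omega : 'M[R]_n) (lam : 'I_n -> R) (v : 'I_n -> 'cV[R]_n).

Definition psdmx Q : Prop := forall x : 'cV[R]_n, 0 <= (x^T *m Q *m x) 0 0.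

(* Indices start at 0, so that the index of the eigenvalue 0 is n.-1. *)
Definition laplacian_eigenbasis Q lam v : Prop :=
  [/\ forall k, Q *m v k = lam k *: v k,
      forall k l, ((v k)^T *m v l) 0 0 = (k == l)%:R,
      forall k l : 'I_n, (k <= l)%N -> lam l <= lam k,
      forall k : 'I_n, (k < n.-1)%N -> 0 < lam k
    & forall k : 'I_n, k = n.-1 :> nat ->
        lam k = 0 /\ v k = const_mx (Num.sqrt n%:R)^-1].

Definition embedding_mx lam v : 'M[R]_(n.-1, n) :=
  \matrix_(k < n.-1, i < n)
    let k' := widen_ord (leq_pred n) k in
    (Num.sqrt (lam k'))^-1 * v k' i 0.

Definition resistance_mx Q : 'M[R]_n :=
  \matrix_(a < n, b < n)
    let e : 'cV[R]_n := delta_mx a 0 - delta_mx b 0 in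
    (e^T *m mpinv Q *m e) 0 0.

(* [invmx] is the identity on singular matrices; the resistance matrix of a
   psd Laplacian of corank 1 and order at least 2 is invertible. *)
Definition invsum Omega : R :=
  ((const_mx 1 : 'cV[R]_n)^T *m invmx Omega *m (const_mx 1 : 'cV[R]_n)) 0 0.

End Resistance.

(* Main.v *)
Require Import Defs.
From mathcomp Require Import all_boot all_order all_algebra.
From mathcomp Require Import boolp classical_sets reals.
From mathcomp Require Import ring lra.

Set Implicit Arguments.
Unset Strict Implicit.
Unset Printing Implicit Defensive.

Import Order.TTheory GRing.Theory Num.Theory.
Local Open Scope ring_scope.

(** On the eigenbasis [v] the Gram matrix [B^T B] of the embedding acts by
    [lam k ^-1] (with [0^-1 = 0]), so it is the pseudoinverse of [Q] and [Omega]
    is the matrix of squared distances between the points [w i].  Expanding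
    squares, if [Omega p = t 1] with [1^T p = 1] and [z] is the barycenter of the
    [w i] with weights [p], then [|z - w i|^2 = t / 2] for all [i]; if instead
    [1^T p = 0], then [z = 0], and affine independence gives [p = 0].  Hence
    [Omega] is invertible, [1^T Omega^-1 1 <> 0], and normalizing [Omega^-1 1]
    gives the circumcenter. *)

(** * Euclidean inner product *)

Section Dot.
Variables (R : realType) (d : nat).
Implicit Types x y z : 'cV[R]_d.

Definition dotv x y : R := (x^T *m y) 0 0.

Lemma dotvE x y : dotv x y = \sum_i x i 0 * y i 0.
Proof. by rewrite /dotv mxE; apply: eq_bigr => i _; rewrite mxE. Qed.

Lemma dotvC x y : dotv x y = dotv y x.
Proof. by rewrite !dotvE; apply: eq_bigr => i _; rewrite mulrC. Qed.

Lemma dotvBr x y z : dotv x (y - z) = dotv x y - dotv x z.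
Proof. by rewrite /dotv mulmxBr !mxE. Qed.

Lemma dotvBl x y z : dotv (x - y) z = dotv x z - dotv y z.
Proof. by rewrite dotvC dotvBr !(dotvC z). Qed.

Lemma dotv_sumr (I : finType) x (a : I -> R) (f : I -> 'cV[R]_d) :
  dotv x (\sum_i a i *: f i) = \sum_i a i * dotv x (f i).
Proof.
rewrite /dotv mulmx_sumr summxE; apply: eq_bigr => i _.
by rewrite -scalemxAr mxE.
Qed.

Lemma dotv_ge0 x : 0 <= dotv x x.
Proof. by rewrite dotvE sumr_ge0 // => i _; rewrite -expr2 sqr_ge0. Qed.

Lemma dotv_eq0 x : dotv x x = 0 -> x = 0.
Proof.
rewrite dotvE => /eqP; rewrite psumr_eq0 => [/allP h|i _]; last first.
  by rewrite -expr2 sqr_ge0.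
apply/colP => i; have := h i (mem_index_enum i).
by rewrite /= -expr2 sqrf_eq0 [RHS]mxE => /eqP.
Qed.

Lemma dotv_sqB x y : dotv (x - y) (x - y) = dotv x x - 2 * dotv x y + dotv y y.
Proof. by rewrite dotvBr !dotvBl (dotvC y x); ring. Qed.

Lemma enormE x : enorm x = Num.sqrt (dotv x x).
Proof. by rewrite dotvE; congr Num.sqrt; apply: eq_bigr => i _; rewrite expr2. Qed.

Lemma sqr_enorm x : enorm x ^+ 2 = dotv x x.
Proof. by rewrite enormE sqr_sqrtr // dotv_ge0. Qed.

End Dot.

(** * Vertices and circumcenters of convex hulls *)

Section ConvexHull.
Variables (R : realType) (d k : nat) (w : 'I_k -> 'cV[R]_d).

Lemma sum_delta (i : 'I_k) : \sum_j (j == i)%:R = 1 :> R.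
Proof. by rewrite (bigD1 i) //= eqxx big1 ?addr0 // => j /negbTE ->. Qed.

Lemma sum_delta_scale (i : 'I_k) : \sum_j (j == i)%:R *: w j = w i.
Proof.
rewrite (bigD1 i) //= eqxx scale1r big1 ?addr0 // => j /negbTE ->.
by rewrite scale0r.
Qed.

Lemma conv_hull_gen i : conv_hull w (w i).
Proof.
exists (fun j => (j == i)%:R); split; last by rewrite sum_delta_scale.
  by move=> j; rewrite ler0n.
exact: sum_delta.
Qed.

(** Substituting the convex weights [c j] of each [y j] into an affine combination of the [y j]
    gives weights on the [w i] that again sum to 1. *)
Lemma affine_hull_conv_hull x :
  affine_hull (conv_hull w) x <->
  exists2 a : 'I_k -> R, \sum_i a i = 1 & x = \sum_i a i *: w i.
Proof.
split=> [[m [y [b [Sy b1 ->]]]]|[a a1 ->]]; last first.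
  by exists k, w, a; split=> // i; exact: conv_hull_gen.
have /choice[c hc] : forall j, exists c : 'I_k -> R,
    \sum_i c i = 1 /\ y j = \sum_i c i *: w i.
  by move=> j; have [c [_ c1 yj]] := Sy j; exists c.
exists (fun i => \sum_j b j * c j i).
  rewrite exchange_big /= -b1; apply: eq_bigr => j _.
  by rewrite -mulr_sumr (hc j).1 mulr1.
under [RHS]eq_bigr do rewrite scaler_suml.
rewrite exchange_big /=; apply: eq_bigr => j _.
by rewrite (hc j).2 scaler_sumr; apply: eq_bigr => i _; rewrite scalerA.
Qed.

(* If [a i > 0], then [x] lies strictly between [w i] and the point of the hull
   obtained by removing the weight [a i / 2] of [w i] and renormalizing. *)
Lemma vertices_conv_hull_sub x : vertices (conv_hull w) x -> exists i, x = w i.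
Proof.
move=> [[a [a_ge0 a1 xE]] ext].
have [i ai_gt0] : exists i, 0 < a i.
  apply: contrapT => /forallNP h; have : \sum_i a i <= 0.
    by apply: sumr_le0 => i _; rewrite leNgt; apply/negP/h.
  by rewrite a1; lra.
have ai_le1 : a i <= 1.
  by rewrite -a1 (bigD1 i) //= lerDl sumr_ge0.
exists i; set t := a i / 2.
have t_lt1 : 0 < 1 - t by rewrite /t; lra.
have t_neq1 : 1 - t != 0 by rewrite gt_eqF.
pose b j := (1 - t)^-1 * (a j - t * (j == i)%:R).
have bE : (1 - t) *: (\sum_j b j *: w j) = x - t *: w i.
  rewrite scaler_sumr xE -[in RHS](sum_delta_scale i) scaler_sumr -sumrB.
  apply: eq_bigr => j _; rewrite /b !scalerA mulVKf //.
  by rewrite scalerBl.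
have [] // := ext (w i) (\sum_j b j *: w j) t (conv_hull_gen i).
- exists b; split=> [j||//].
    rewrite mulr_ge0 ?invr_ge0 ?(ltW t_lt1) //.
    case: eqVneq => [->|_]; last by rewrite mulr0 subr0.
    by rewrite mulr1 /t; lra.
  by rewrite -mulr_sumr sumrB a1 -mulr_sumr sum_delta mulr1 mulVf.
- by rewrite /t; lra.
- by rewrite bE addrC subrK.
Qed.

Hypothesis aw : affinely_independent w.

(** Uniqueness of barycentric coordinates. *)
Lemma affinely_independent_inj (a b : 'I_k -> R) :
  \sum_i a i = \sum_i b i -> \sum_i a i *: w i = \sum_i b i *: w i -> a =1 b.
Proof.
move=> s e i; apply/eqP; rewrite -subr_eq0; apply/eqP.
apply: (@aw (fun i => a i - b i)); first by rewrite sumrB s subrr.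
by under eq_bigr do rewrite scalerBl; rewrite sumrB e subrr.
Qed.

(** The coordinates of [w i] vanish away from [i]. There they are a positive combination of the
    nonnegative coordinates of [y] and [z], which therefore vanish as well. *)
Lemma vertices_conv_hull_gen i : vertices (conv_hull w) (w i).
Proof.
split=> [|y z t [b [b0 b1 ->]] [c [c0 c1 ->]] /andP[t0 t1] e].
  exact: conv_hull_gen.
have bc : (fun j => (j == i)%:R) =1 (fun j => t * b j + (1 - t) * c j).
  apply: affinely_independent_inj.
    by rewrite sum_delta big_split /= -!mulr_sumr b1 c1; ring.
  rewrite sum_delta_scale e !scaler_sumr -big_split /=.
  by apply: eq_bigr => j _; rewrite !scalerA -scalerDl.
have bc0 j : j != i -> b j = 0 /\ c j = 0.
  move=> /negbTE ji; have := bc j; rewrite /= ji; have := b0 j; have := c0 j.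
  move=> c0j b0j /esym/eqP; rewrite paddr_eq0 ?mulr_ge0 //; [|lra..].
  rewrite !mulf_eq0 [t == 0]gt_eqF // [1 - t == 0]gt_eqF ?subr_gt0 //=.
  by move=> /andP[/eqP-> /eqP->].
have vE (f : 'I_k -> R) : \sum_i f i = 1 -> (forall j, j != i -> f j = 0) ->
    \sum_j f j *: w j = w i.
  move=> f1 f0; rewrite (bigD1 i) //= big1 ?addr0 => [|j /f0->]; last first.
    by rewrite scale0r.
  suff -> : f i = 1 by rewrite scale1r.
  by rewrite -f1 (bigD1 i) //= big1 ?addr0.
by split; apply: vE => // j /bc0 [].
Qed.

(* Equidistance makes [c - c'] have the same inner product with every vertex,
   hence be orthogonal to the direction of the affine hull, where it lies. *)
Lemma circumscribed_uniq c c' r r' :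
  circumscribed (conv_hull w) c r -> circumscribed (conv_hull w) c' r' -> c = c'.
Proof.
move=> [/affine_hull_conv_hull[a a1 cE] _ hc].
move=> [/affine_hull_conv_hull[b b1 c'E] _ hc'].
set y := c - c'.
(* Found by subtracting the expansions of [|c - w i|^2 = r^2] and [|c' - w i|^2 = r'^2]. *)
pose K := 2^-1 * (dotv c c - dotv c' c' - r ^+ 2 + r' ^+ 2).
have yw i : dotv y (w i) = K.
  have := sqr_enorm (c - w i); have := sqr_enorm (c' - w i).
  rewrite (hc _ (vertices_conv_hull_gen i)) (hc' _ (vertices_conv_hull_gen i)).
  by rewrite !dotv_sqB /y /K dotvBl; lra.
apply/eqP; rewrite -subr_eq0; apply/eqP/dotv_eq0; rewrite -/y {2}/y cE c'E.
have yS (f : 'I_k -> R) : dotv y (\sum_i f i *: w i) = (\sum_i f i) * K.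
  by rewrite dotv_sumr mulr_suml; apply: eq_bigr => i _; rewrite yw.
by rewrite dotvBr !yS a1 b1 subrr.
Qed.

End ConvexHull.

(** * Squared distance matrices *)

Section DistanceMatrix.
Variables (R : realType) (d n : nat) (w : 'I_n -> 'cV[R]_d).

Definition sqdist_mx : 'M[R]_n :=
  \matrix_(a < n, b < n) dotv (w a - w b) (w a - w b).

(** Weights of any sum are allowed: those of sum 0 enter the proof of invertibility. *)
Definition bary (x : 'cV[R]_n) : 'cV[R]_d := \sum_i x i 0 *: w i.

Lemma sqdist_mx_mul (x : 'cV[R]_n) i :
  (sqdist_mx *m x) i 0 = (\sum_j x j 0) * dotv (w i) (w i)
    - 2 * dotv (w i) (bary x) + \sum_j x j 0 * dotv (w j) (w j).
Proof.
rewrite mxE dotv_sumr mulr_suml mulr_sumr -sumrB -big_split /=.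
by apply: eq_bigr => j _; rewrite mxE dotv_sqB; ring.
Qed.

(* Weighting the equations [sqdist_mx *m x = t] by [x] itself. *)
Lemma sqdist_mx_quad (x : 'cV[R]_n) t :
  sqdist_mx *m x = const_mx t -> t * \sum_j x j 0 =
  2 * ((\sum_j x j 0) * (\sum_j x j 0 * dotv (w j) (w j)) - dotv (bary x) (bary x)).
Proof.
move=> e; set s := \sum_j x j 0; set K := \sum_j x j 0 * _.
have : \sum_i x i 0 * (sqdist_mx *m x) i 0 = s * K
    - 2 * dotv (bary x) (bary x) + \sum_i x i 0 * K.
  rewrite {2}/bary dotv_sumr {1}/K !mulr_sumr -sumrB.
  rewrite -big_split /=.
  apply: eq_bigr => i _; rewrite sqdist_mx_mul -/s -/K (dotvC (bary x)); ring.
under eq_bigr do rewrite e mxE.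
by rewrite -!mulr_suml -/s => h; rewrite mulrC h; ring.
Qed.

(** With [K] the weighted sum of the [|w j|^2] and [z = bary x], the quadratic identity gives
    [K - |z|^2 = t / 2], and row [i] gives [|z - w i|^2 = |z|^2 + t - K]. *)
Lemma sqdist_mx_equidistant (x : 'cV[R]_n) t i :
  \sum_j x j 0 = 1 -> sqdist_mx *m x = const_mx t ->
  dotv (bary x - w i) (bary x - w i) = 2^-1 * t.
Proof.
move=> x1 e; have := sqdist_mx_quad e; have := sqdist_mx_mul x i.
rewrite e mxE x1 dotv_sqB (dotvC (bary x)); lra.
Qed.

Hypothesis aw : affinely_independent w.

(** The quadratic identity forces [bary x = 0], so [x] is an affine dependency of the [w i]. *)
Lemma sqdist_mx_sum0 (x : 'cV[R]_n) t :
  \sum_j x j 0 = 0 -> sqdist_mx *m x = const_mx t -> x = 0.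
Proof.
move=> x0 e; have := sqdist_mx_quad e; rewrite x0 mulr0 mul0r sub0r => h.
have /dotv_eq0 bx0 : dotv (bary x) (bary x) = 0 by lra.
by apply/colP => i; rewrite mxE (@aw (fun i => x i 0)).
Qed.

Hypothesis n_ge2 : (2 <= n)%N.

(* A kernel vector with nonzero sum would put all points at distance [0] from
   a common barycenter. *)
Lemma sqdist_mx_unit : sqdist_mx \in unitmx.
Proof.
suff ker0 (x : 'cV[R]_n) : sqdist_mx *m x = 0 -> x = 0.
  (* [kermx] is a left kernel, hence the passage to the transpose. *)
  rewrite -unitmx_tr -row_free_unit -kermx_eq0; apply/eqP/row_matrixP => i.
  rewrite row0; apply: trmx_inj; rewrite trmx0; apply: ker0.
  by apply: trmx_inj; rewrite trmx_mul trmxK -row_mul mulmx_ker row0 trmx0.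
move=> e; have [x0|x_neq0] := eqVneq (\sum_j x j 0) 0.
  by apply: (sqdist_mx_sum0 (t := 0)).
pose y := (\sum_j x j 0)^-1 *: x.
have y1 : \sum_j y j 0 = 1.
  by under eq_bigr do rewrite mxE; rewrite -mulr_sumr mulVf.
have ye : sqdist_mx *m y = const_mx 0 by rewrite -scalemxAr e scaler0.
have wE i : w i = bary y.
  apply/esym/eqP; rewrite -subr_eq0; apply/eqP/dotv_eq0.
  by rewrite (sqdist_mx_equidistant i y1 ye) mulr0.
(* Two distinct indices with the same point contradict affine independence. *)
pose i0 : 'I_n := Ordinal (ltnW n_ge2); pose i1 : 'I_n := Ordinal n_ge2.
have := @affinely_independent_inj _ _ _ _ aw (fun j => (j == i0)%:R)
  (fun j => (j == i1)%:R).
rewrite !sum_delta !sum_delta_scale !wE => /(_ erefl erefl i0).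
by rewrite eqxx => /eqP; rewrite oner_eq0.
Qed.

Lemma invsumE (A : 'M[R]_n) : invsum A = \sum_j (invmx A *m const_mx 1 : 'cV_n) j 0.
Proof.
rewrite /invsum -mulmxA mxE; apply: eq_bigr => j _.
by rewrite !mxE mul1r.
Qed.

(** Otherwise the preimage of the all-ones vector would have sum 0, hence be 0. *)
Lemma invsum_sqdist_mx_neq0 : invsum sqdist_mx != 0.
Proof.
apply/eqP; rewrite invsumE => s0.
have e : sqdist_mx *m (invmx sqdist_mx *m const_mx 1) = const_mx 1 :> 'cV_n.
  by rewrite mulKVmx // sqdist_mx_unit.
have := e; rewrite (sqdist_mx_sum0 s0 e) mulmx0 => /colP.
move=> /(_ (Ordinal n_ge2)) /eqP; rewrite !mxE eq_sym oner_eq0 //.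
Qed.

Lemma circumscribed_sqdist_mx :
  let p : 'cV[R]_n := (invsum sqdist_mx)^-1 *: (invmx sqdist_mx *m const_mx 1) in
  let sigma2 : R := 2^-1 * (invsum sqdist_mx)^-1 in
  (forall i, dotv (bary p - w i) (bary p - w i) = sigma2) /\
  circumscribed (conv_hull w) (bary p) (Num.sqrt sigma2).
Proof.
move=> p sigma2; have s_neq0 := invsum_sqdist_mx_neq0.
have p1 : \sum_j p j 0 = 1.
  by under eq_bigr do rewrite mxE; rewrite -mulr_sumr -invsumE mulVf.
have pe : sqdist_mx *m p = const_mx (invsum sqdist_mx)^-1.
  rewrite -scalemxAr mulKVmx ?sqdist_mx_unit //.
  by apply/colP => i; rewrite !mxE mulr1.
have eqd i := sqdist_mx_equidistant i p1 pe.
split=> //; split; last by move=> _ /vertices_conv_hull_sub[i ->]; rewrite enormE eqd.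
  by apply/affine_hull_conv_hull; exists (fun i => p i 0).
exact: sqrtr_ge0.
Qed.

End DistanceMatrix.

(** * The resistive embedding and the pseudoinverse *)

Section Embedding.
Variables (R : realType) (n : nat) (Q : 'M[R]_n).
Variables (lam : 'I_n -> R) (v : 'I_n -> 'cV[R]_n).
Hypothesis Q_sym : Q^T = Q.
Hypothesis eig : laplacian_eigenbasis Q lam v.

Let B := embedding_mx lam v.

(** The matrix with columns [v k] is orthogonal, hence invertible. *)
Lemma eigenbasis_ext (A A' : 'M[R]_n) :
  (forall k, A *m v k = A' *m v k) -> A = A'.
Proof.
have [_ on _ _ _] := eig; move=> h.
pose V : 'M[R]_n := \matrix_(i, k) v k i 0.
have mulV (M : 'M[R]_n) i k : (M *m V) i k = (M *m v k) i 0.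
  by rewrite !mxE; apply: eq_bigr => j _; rewrite mxE.
have VV : V^T *m V = 1%:M.
  apply/matrixP => k l; rewrite !mxE -on mxE; apply: eq_bigr => i _.
  by rewrite !mxE.
have [uV _] := mulmx1_unit VV.
have uV' : V \in unitmx by rewrite -unitmx_tr.
rewrite -[A](mulmxK uV') -[A'](mulmxK uV'); congr (_ *m _).
by apply/matrixP => i k; rewrite !mulV h.
Qed.

(* At the last index both sides vanish, because [0^-1 = 0]. *)
Lemma gram_embedding_eigen l : B^T *m B *m v l = (lam l)^-1 *: v l.
Proof.
have [_ on _ lam_gt0 lam0] := eig.
have Bv k : (B *m v l) k 0 =
    (Num.sqrt (lam l))^-1 * (widen_ord (leq_pred n) k == l)%:R.
  set k' := widen_ord _ k.
  have -> : (B *m v l) k 0 = (Num.sqrt (lam k'))^-1 * ((v k')^T *m v l) 0 0.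
    rewrite !mxE mulr_sumr; apply: eq_bigr => i _.
    by rewrite !mxE mulrA.
  by rewrite on; case: eqVneq => [->|]; rewrite ?mulr0.
rewrite -mulmxA; apply/colP => i; rewrite mxE.
under eq_bigr do rewrite Bv.
have [ln|ln] := ltnP l n.-1.
  rewrite (bigD1 (Ordinal ln)) //= big1 ?addr0 => [|k kl].
    have -> : widen_ord (leq_pred n) (Ordinal ln) = l by apply: val_inj.
    rewrite eqxx !mxE mulr1.
    have -> : widen_ord (leq_pred n) (Ordinal ln) = l by apply: val_inj.
    by rewrite mulrAC -invfM -expr2 sqr_sqrtr // ltW // lam_gt0.
  case: eqP => [e|_]; last by rewrite !mulr0.
  by case/eqP: kl; apply: val_inj; rewrite /= -e.
have l_last : l = n.-1 :> nat.
  by apply/eqP; rewrite eqn_leq ln andbT -ltnS (leq_trans (ltn_ord l)) ?leqSpred.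
have [-> _] := lam0 l l_last.
rewrite invr0 scale0r mxE big1 // => k _.
(* The image of [widen_ord] misses the last index. *)
case: eqP => [e|_]; last by rewrite !mulr0.
by move: ln; rewrite -e /= leqNgt ltn_ord.
Qed.

(** Both matrices are diagonal in the basis [v], so they commute, which gives the two symmetry
    conditions; the other two reduce to a scalar identity on eigenvalues. *)
Lemma mpinv_gram : mpinv Q = B^T *m B.
Proof.
have [Qv _ _ _ _] := eig; set G := B^T *m B.
have Gt : G^T = G by rewrite trmx_mul trmxK.
have Gv l : G *m v l = (lam l)^-1 *: v l := gram_embedding_eigen l.
clearbody G; have QG : Q *m G = G *m Q.
  apply: eigenbasis_ext => k; rewrite -!mulmxA Qv Gv -!scalemxAr Qv Gv.
  by rewrite !scalerA mulrC.
have lamK (x : R) : x * x^-1 * x = x.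
  by have [->|x0] := eqVneq x 0; rewrite ?mulr0 // mulfV ?mul1r.
apply: penrose_uniq (mpinvP Q) _; split.
- apply: eigenbasis_ext => k; rewrite -!mulmxA Qv -!scalemxAr Gv -!scalemxAr Qv.
  by rewrite !scalerA lamK.
- apply: eigenbasis_ext => k; rewrite -!mulmxA Gv -!scalemxAr Qv -!scalemxAr Gv.
  by rewrite !scalerA -{2}[lam k]invrK lamK.
- by rewrite trmx_mul Q_sym Gt QG.
- by rewrite trmx_mul Q_sym Gt QG.
Qed.

Let w (i : 'I_n) : 'cV[R]_n.-1 := B *m delta_mx i 0.

Lemma resistance_mxE : resistance_mx Q = sqdist_mx w.
Proof.
apply/matrixP => a b; rewrite !mxE mpinv_gram /dotv /w.
by rewrite -mulmxBr trmx_mul !mulmxA.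
Qed.

Lemma embedding_bary (x : 'cV[R]_n) : B *m x = bary w x.
Proof.
rewrite {1}(matrix_sum_delta x) mulmx_sumr; apply: eq_bigr => i _.
by rewrite big_ord1 scalemxAr.
Qed.

(** Since [Q] commutes with its pseudoinverse [B^T B], [Q x = Q Q B^T B x]. So [B x = 0] puts [x] in
    the kernel of [Q], and a constant vector of sum 0 is 0. *)
Lemma embedding_affinely_independent :
  (forall x : 'cV[R]_n, Q *m x = 0 -> exists c : R, x = c *: const_mx 1) ->
  affinely_independent w.
Proof.
move=> Q_ker a a0 aw i; pose x := \col_i a i.
have Bx : B *m x = 0.
  by rewrite embedding_bary -aw; apply: eq_bigr => j _; rewrite mxE.
have [QGQ _ QGt _] := mpinvP Q.
have /Q_ker[c xE] : Q *m x = 0.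
  have QGc : Q *m mpinv Q = mpinv Q *m Q.
    by rewrite -QGt trmx_mul mpinv_gram trmx_mul trmxK Q_sym.
  by rewrite -QGQ -[_ *m _ *m Q]mulmxA -QGc mpinv_gram -!mulmxA Bx !mulmx0.
have aE j : a j = c by have /colP/(_ j) := xE; rewrite !mxE mulr1.
move/eqP: a0; under eq_bigr do rewrite aE.
(* The sum is [c *+ n]; the index [i] rules out [n = 0]. *)
rewrite sumr_const card_ord mulrn_eq0 => /orP[/eqP n0|/eqP c0].
  by have := ltn_ord i; rewrite {2}n0.
by rewrite aE.
Qed.

End Embedding.

Theorem theorem4p5 (R : realType) (n : nat) (n_ge2 : (2 <= n)%N)
    (Q : 'M[R]_n) (Q_sym : Q^T = Q) (Q_psd : psdmx Q)
    (Q_ker : forall x : 'cV[R]_n,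
      Q *m x = 0 <-> exists c : R, x = c *: const_mx 1)
    (lam : 'I_n -> R) (v : 'I_n -> 'cV[R]_n)
    (eig : laplacian_eigenbasis Q lam v) :
  let phi (f : 'cV[R]_n) : 'cV[R]_n.-1 := embedding_mx lam v *m f in
  let w (i : 'I_n) : 'cV[R]_n.-1 := phi (delta_mx i 0) in
  let S := conv_hull w in
  let Omega := resistance_mx Q in
  let p : 'cV[R]_n := (invsum Omega)^-1 *: (invmx Omega *m const_mx 1) in
  let sigma2 : R := 2^-1 * (invsum Omega)^-1 in
  let sigma : R := Num.sqrt sigma2 in
  [/\ affinely_independent w,
      is_circumcenter S (phi p),
      is_circumradius S sigma
    & forall i : 'I_n, enorm (phi p - phi (delta_mx i 0)) ^+ 2 = sigma2].
Proof.
move=> phi w S Omega p sigma2 sigma.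
have aw : affinely_independent w.
  by apply: (embedding_affinely_independent (Q := Q)) => // x /Q_ker.
have OmegaE : Omega = sqdist_mx w by apply: resistance_mxE.
have phip : phi p = bary w p by apply: embedding_bary.
have [eqd circ] := circumscribed_sqdist_mx aw n_ge2.
rewrite -OmegaE -/p -/sigma2 -/sigma -phip in eqd circ.
have center : is_circumcenter S (phi p).
  split; first by exists sigma.
  (* A competing center may come with its own radius [r']. *)
  by move=> c' [r' circ']; apply: circumscribed_uniq circ circ'.
split=> //; first by exists (phi p).
by move=> i; rewrite sqr_enorm eqd.
Qed.
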